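(* (i) There are a homeomorphism $\Theta\colon\Omega\to L(\mathscr A)$ and a continuous surjective map $\pi\colon\Omega\to\mathbb Z_2$ given by $\pi(w)=\delta(\Theta(w))$, where $\delta\colon L(\mathscr A)\to\mathbb Z_2$ replaces each label $i_j$ by the binary digit $i$ (that is, $\delta$ sends the path with labels $(i_0)_{j_0}(i_1)_{j_1}(i_2)_{j_2}\cdots$ to $\sum_{n\ge0}i_n2^n$), such that $\pi(\sigma(w))=\pi(w)+1$ for all $w\in\Omega$. The map $\pi$ is $2:1$ over $\mathbb Z_2\setminus\mathbb Z$ and $4:1$ over $\mathbb Z\subset\mathbb Z_2$ (that is, $|\pi^{-1}(z)|=2$ for $z\in\mathbb Z_2\setminus\mathbb Z$ and $|\pi^{-1}(z)|=4$ for $z\in\mathbb Z$). (ii) There is a homeomorphism $\Omega\to\mathbb Z/2\times\widetilde{\mathbb Z}_2$ under which the shift $\sigma$ of $\Omega$ is transported to the map $$(s,z)\mapsto(s+\phi(z+1),\,z+1),$$ and under which the factor map $\pi$ becomes the composition of the projection $\mathbb Z/2\times\widetilde{\mathbb Z}_2\to\widetilde{\mathbb Z}_2$ with the natural map $\widetilde{\mathbb Z}_2\to\mathbb Z_2$.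
   Context: **Thue-Morse shift.** $\zeta$ is the endomorphism of the free monoid $\{0,1\}^*$ given by $0\mapsto01$, $1\mapsto10$. $\Omega\subset\{0,1\}^{\mathbb Z}$ is the set of bi-infinite words $w$ all of whose finite subwords occur in $\zeta^n(0)$ for some $n$, with the topology induced from the product topology. The shift is $\sigma(w)_n=w_{n+1}$. **The automaton $\mathscr A$.** $\mathscr A$ is the directed graph with vertices $a,b,c,d,e,f$ and the following twelve labelled edges: $1_b\colon a\to b$; $1_c\colon a\to c$; $1_a\colon b\to a$; $0_c\colon b\to c$; $0_b\colon c\to b$; $0_f\colon c\to f$; $0_a\colon d\to a$; $0_e\colon d\to e$; $0_d\colon e\to d$; $1_f\colon e\to f$; $1_d\colon f\to d$; $1_e\colon f\to e$. (The subscript is the end vertex of the edge.) $L(\mathscr A)$ is the space of right-infinite directed paths in $\mathscr A$, starting at any vertex, identified with their label sequences; two paths are close if they agree on a long initial segment. **The space $\widetilde{\mathbb Z}_2$.** $\mathbb Z_2$ denotes the $2$-adic integers. As a set $\widetilde{\mathbb Z}_2=(\mathbb Z_2\setminus\mathbb Z)\sqcup(\mathbb Z\times\mathbb Z/2)$; the natural map $\widetilde{\mathbb Z}_2\to\mathbb Z_2$ is the identity on $\mathbb Z_2\setminus\mathbb Z$ and $(n,t)\mapsto n$ on $\mathbb Z\times\mathbb Z/2$. The group $\mathbb Z$ acts on $\widetilde{\mathbb Z}_2$, with generator written $z\mapsto z+1$, by the usual $z\mapsto z+1$ on $\mathbb Z_2\setminus\mathbb Z$ and $(n,t)\mapsto(n+1,t)$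 on $\mathbb Z\times\mathbb Z/2$. Topology: the preimages of open subsets of $\mathbb Z_2$ are open; basic open neighbourhoods of $(0,t)$ (with $t\in\{0,1\}$) are, for $N\in\mathbb N$, the sets consisting of $(0,t)$ together with all points of $\widetilde{\mathbb Z}_2$ lying over $\bigsqcup_{n\ge N}2^{2n+t}(2\mathbb Z_2+1)$; and all $\mathbb Z$-translates of these sets are open; these sets generate the topology. **The cocycle.** $\phi\colon\widetilde{\mathbb Z}_2\to\mathbb Z/2$ is defined as follows: if $z\in\widetilde{\mathbb Z}_2$ lies over an element of $2^n(2\mathbb Z_2+1)$, $n\ge0$, then $\phi(z)=n+1\bmod2$; and $\phi(0,t)=t+1\bmod 2$. *)

(* Defs.v *)
From HB Require Import structures.
From mathcomp Require Import all_boot all_order all_algebra.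
From mathcomp Require Import all_classical topology.

Set Implicit Arguments.
Unset Strict Implicit.
Unset Printing Implicit Defensive.

Import GRing.Theory.
Local Open Scope classical_set_scope.
Local Open Scope ring_scope.

HB.instance Definition _ (n : nat) := hasNbhs.Build 'I_n principal_filter.
HB.instance Definition _ (n : nat) := Discrete_ofNbhs.Build 'I_n erefl.

Definition homeomorphism (X Y : topologicalType) (f : X -> Y) : Prop :=
  continuous f /\
  exists g : Y -> X, [/\ cancel f g, cancel g f & continuous g].

(** The letters 0 and 1 are [false] and [true]. *)

Definition zeta (u : seq bool) : seq bool :=
  flatten [seq [:: x; ~~ x] | x <- u].

Definition biword : topologicalType := prod_topology (fun _ : int => bool).

Definition subword (w : biword) (m : int) (l : nat) : seq bool :=
  [seq w (m + k%:Z) | k <- iota 0 l].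

Definition Omega : set biword :=
  [set w | forall (m : int) (l : nat),
     exists n : nat, infix (subword w m l) (iter n zeta [:: false])].

Definition shift (w : biword) : biword := fun n => w (n + 1).

Lemma shift_Omega (w : biword) : Omega w -> Omega (shift w).
Proof.
move=> Ow m l; have [n Hn] := Ow (m + 1) l; exists n.
rewrite (_ : subword (shift w) m l = subword w (m + 1) l) //.
by apply: eq_map => k; rewrite /shift addrAC.
Qed.

Definition sigma (w : Omega) : Omega :=
  exist _ (shift (val w)) (mem_set (shift_Omega (set_mem (valP w)))).

Variant vertex := va | vb | vc | vd | ve | vf.

Definition vertex_rank (v : vertex) : 'I_6 :=
  match v with
  | va => inord 0 | vb => inord 1 | vc => inord 2
  | vd => inord 3 | ve => inord 4 | vf => inord 5
  end.

Definition vertex_of_rank (i : 'I_6) : vertex :=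
  nth va [:: va; vb; vc; vd; ve; vf] i.

Lemma vertex_rankK : cancel vertex_rank vertex_of_rank.
Proof. by case; rewrite /vertex_of_rank /= inordK. Qed.

HB.instance Definition _ := Finite.copy vertex (can_type vertex_rankK).
HB.instance Definition _ := hasNbhs.Build vertex principal_filter.
HB.instance Definition _ := Discrete_ofNbhs.Build vertex erefl.

(** The label [i_j] is the pair [(i, j)]. *)
Definition label : topologicalType := (bool * vertex)%type.

(** (start vertex, label, end vertex) *)
Definition edges : seq (vertex * label * vertex) :=
  [:: (va, (true,  vb), vb); (va, (true,  vc), vc);
      (vb, (true,  va), va); (vb, (false, vc), vc);
      (vc, (false, vb), vb); (vc, (false, vf), vf);
      (vd, (false, va), va); (vd, (false, ve), ve);
      (ve, (false, vd), vd); (ve, (true,  vf), vf);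
      (vf, (true,  vd), vd); (vf, (true,  ve), ve)].

(** The product topology is the one in which two paths are close when they
    agree on a long initial segment. *)
Definition LA : set (prod_topology (fun _ : nat => label)) :=
  [set p | exists v : nat -> vertex,
     forall n : nat, (v n, p n, v n.+1) \in edges].

(** [Z2] is the ring of 2-adic integers, built as the inverse limit of the rings
    Z/2^(n+1); the exponent starts at 1 because ['Z_1] is not the zero ring. *)

Definition reduce n (x : 'Z_(2 ^ n.+2)) : 'Z_(2 ^ n.+1) := (x : nat)%:R.

Definition coherent : set (prod_topology (fun n : nat => 'Z_(2 ^ n.+1))) :=
  [set x | forall n : nat, @reduce n (x n.+1) = x n].

Definition Z2 : Type := coherent.
HB.instance Definition _ := Topological.copy Z2 (set_type coherent).

Definition residue (x : Z2) (n : nat) : 'Z_(2 ^ n.+1) := val x n.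

Lemma residueP (x y : Z2) : (forall n, residue x n = residue y n) -> x = y.
Proof.
by move=> e; apply: val_inj; apply: functional_extensionality_dep => n; exact: e.
Qed.

Lemma residue_coh (x : Z2) n : reduce (residue x n.+1) = residue x n.
Proof. by case: x => x xP; exact: (set_mem xP n). Qed.

Lemma pow2_gt1 n : (1 < 2 ^ n.+1)%N.
Proof. by rewrite -{1}(expn0 2) ltn_exp2l. Qed.

Lemma reduce_nat n (k : nat) : @reduce n k%:R = k%:R.
Proof.
rewrite /reduce; apply: val_inj; rewrite /= !val_Zp_nat ?pow2_gt1 //.
by rewrite modn_dvdm // dvdn_exp2l.
Qed.

Lemma reduceD n : {morph @reduce n : x y / x + y}.
Proof.
by move=> x y; rewrite -[x]natr_Zp -[y]natr_Zp -natrD !reduce_nat natrD.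
Qed.

Lemma reduceM n : {morph @reduce n : x y / x * y}.
Proof.
by move=> x y; rewrite -[x]natr_Zp -[y]natr_Zp -natrM !reduce_nat natrM.
Qed.

Lemma reduceN n : {morph @reduce n : x / - x}.
Proof.
move=> x; apply/eqP; rewrite -subr_eq0 opprK -reduceD addNr.
by rewrite (reduce_nat n 0).
Qed.

Definition mkZ2 (f : forall n, 'Z_(2 ^ n.+1))
  (fP : forall n, reduce (f n.+1) = f n) : Z2 :=
  exist _ (f : prod_topology _) (mem_set fP).

Definition Z2_zero : Z2 := mkZ2 (fun n => reduce_nat n 0).
Definition Z2_one : Z2 := mkZ2 (fun n => reduce_nat n 1).

Definition Z2_opp (x : Z2) : Z2.
Proof.
apply: (@mkZ2 (fun n => - residue x n)) => n.
by rewrite reduceN; congr (- _); exact: residue_coh.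
Defined.

Definition Z2_add (x y : Z2) : Z2.
Proof.
apply: (@mkZ2 (fun n => residue x n + residue y n)) => n.
by rewrite reduceD; congr (_ + _); exact: residue_coh.
Defined.

Definition Z2_mul (x y : Z2) : Z2.
Proof.
apply: (@mkZ2 (fun n => residue x n * residue y n)) => n.
by rewrite reduceM; congr (_ * _); exact: residue_coh.
Defined.

Lemma Z2_addA : associative Z2_add.
Proof. by move=> x y z; apply: residueP => n; exact: addrA. Qed.
Lemma Z2_addC : commutative Z2_add.
Proof. by move=> x y; apply: residueP => n; exact: addrC. Qed.
Lemma Z2_add0 : left_id Z2_zero Z2_add.
Proof. by move=> x; apply: residueP => n; exact: add0r. Qed.
Lemma Z2_addN : left_inverse Z2_zero Z2_opp Z2_add.
Proof. by move=> x; apply: residueP => n; exact: addNr. Qed.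
Lemma Z2_mulA : associative Z2_mul.
Proof. by move=> x y z; apply: residueP => n; exact: mulrA. Qed.
Lemma Z2_mulC : commutative Z2_mul.
Proof. by move=> x y; apply: residueP => n; exact: mulrC. Qed.
Lemma Z2_mul1 : left_id Z2_one Z2_mul.
Proof. by move=> x; apply: residueP => n; exact: mul1r. Qed.
Lemma Z2_mulDl : left_distributive Z2_mul Z2_add.
Proof. by move=> x y z; apply: residueP => n; exact: mulrDl. Qed.
Lemma Z2_one_neq0 : Z2_one != Z2_zero.
Proof.
apply/eqP => /(congr1 (residue^~ 0%N)) /eqP.
by rewrite (_ : residue Z2_one 0 = 1) // (_ : residue Z2_zero 0 = 0) ?oner_eq0.
Qed.

HB.instance Definition _ :=
  GRing.isZmodule.Build Z2 Z2_addA Z2_addC Z2_add0 Z2_addN.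
HB.instance Definition _ :=
  GRing.Zmodule_isComNzRing.Build Z2
    Z2_mulA Z2_mulC Z2_mul1 Z2_mulDl Z2_one_neq0.
HB.instance Definition _ := isPointed.Build Z2 (0 : Z2).

Lemma residue_continuous n : continuous (residue^~ n).
Proof.
move=> x; rewrite /residue.
apply: (@continuous_comp Z2 _ _ (fun y : Z2 => val y) (fun f => f n)).
  exact: (@initial_continuous _ _ (fun y : coherent => val y)).
exact: (@proj_continuous _ (fun n : nat => 'Z_(2 ^ n.+1)) n).
Qed.

Lemma Z2_hausdorff : hausdorff_space Z2.
Proof.
move=> x y xy; apply: residueP => n.
have nres (z : Z2) : nbhs z [set t | residue t n = residue z n].
  exact: (@residue_continuous n z _ (discrete_set1 (residue z n))).
by have [t [<- <-]] := xy _ _ (nres x) (nres y).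
Qed.

Lemma cvg_Z2 (u : nat -> Z2) (z : Z2) :
  (forall m, \forall n \near \oo, residue (u n) m = residue z m) ->
  u @ \oo --> z.
Proof.
move=> H; pose pr (y : Z2) : prod_topology (fun n : nat => 'Z_(2 ^ n.+1)) := val y.
have K : (pr \o u) @ \oo --> pr z.
  apply/cvg_sup => m U [B [[C oC <-] Bz BU]].
  apply: filterS (H m) => n e; apply: BU.
  by move: Bz; rewrite /= -[pr z m]/(residue z m) -e.
move=> U [B [[C oC <-] Bz BU]].
have [N _ HN] : \forall n \near \oo, C (pr (u n)).
  by apply: K; apply: open_nbhs_nbhs; split.
by exists N => // n /HN Cn; exact: BU.
Qed.

Definition ZinZ2 : set Z2 := [set z | exists m : int, z = m%:~R].

(** 2^n (2 Z_2 + 1) *)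
Definition level (n : nat) : set Z2 :=
  [set z | exists u : Z2, z = 2 ^+ n * (2 * u + 1)].

Definition delta (p : LA) : Z2 :=
  limn (fun n : nat => \sum_(k < n) ((val p k).1 : nat)%:R * 2 ^+ k : Z2).

Lemma residueD x y n : residue (x + y) n = residue x n + residue y n.
Proof. by []. Qed.

Lemma residue_nat (k n : nat) : residue k%:R n = k%:R.
Proof. by elim: k => // k IH; rewrite -!natr1 residueD IH. Qed.

Lemma delta_sum_nat (p : LA) (n : nat) :
  (\sum_(k < n) ((val p k).1 : nat)%:R * 2 ^+ k : Z2) =
  (\sum_(k < n) ((val p k).1 : nat) * 2 ^ k)%N%:R.
Proof.
by rewrite natr_sum; apply: eq_bigr => k _; rewrite natrM natrX.
Qed.

(** The series defining [delta] converges; its sum is determined by its partial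
    sums modulo the powers of 2. *)
Lemma residue_delta (p : LA) (m : nat) :
  residue (delta p) m = (\sum_(k < m.+1) ((val p k).1 : nat) * 2 ^ k)%N%:R.
Proof.
pose S n := (\sum_(k < n) ((val p k).1 : nat) * 2 ^ k)%N.
have SS i j : (S (i.+1 + j)%N)%:R = (S i.+1)%:R :> 'Z_(2 ^ i.+1).
  elim: j => [|j IH]; first by rewrite addn0.
  rewrite addnS {1}/S big_ord_recr /= natrD IH expnD mulnCA natrM.
  by rewrite (_ : (2 ^ i.+1)%:R = 0) ?mul0r ?addr0 // pchar_Zp // pow2_gt1.
have Sred n : reduce (S n.+2)%:R = (S n.+1)%:R :> 'Z_(2 ^ n.+1).
  by rewrite reduce_nat -(SS n 1%N) addn1.
have -> : delta p = mkZ2 Sred; last by [].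
apply: cvg_lim; first exact: Z2_hausdorff.
apply: cvg_Z2 => i; exists i.+1 => // n /= /subnKC <-.
by rewrite delta_sum_nat residue_nat SS.
Qed.

Variant Ztilde : Type :=
| Nonint of ~` ZinZ2
| Int of int & 'Z_2.

HB.instance Definition _ := gen_eqMixin Ztilde.
HB.instance Definition _ := gen_choiceMixin Ztilde.

Definition Ztilde_Z2 (x : Ztilde) : Z2 :=
  match x with Nonint z => val z | Int n _ => n%:~R end.

Lemma nonint_add (z : ~` ZinZ2) (m : int) : (~` ZinZ2) (val z + m%:~R).
Proof.
have := set_mem (valP z); apply: contra_not => -[k e].
by exists (k - m); rewrite rmorphB /= -e addrK.
Qed.

(** [translate m] is the action of [m], with generator z |-> z + 1. *)
Definition translate (m : int) (x : Ztilde) : Ztilde :=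
  match x with
  | Nonint z => Nonint (exist _ (val z + m%:~R) (mem_set (@nonint_add z m)))
  | Int n t => Int (n + m) t
  end.

(** [(0, t)] together with all points over the 2^(2n+t) (2 Z_2 + 1), n >= N. *)
Definition zero_nbhd (t : 'Z_2) (N : nat) : set Ztilde :=
  [set x | x = Int 0 t \/
     exists2 n : nat, (N <= n)%N & level (2 * n + t)%N (Ztilde_Z2 x)].

Definition Ztilde_subbase : set (set Ztilde) :=
  [set U | (exists2 V : set Z2, open V & U = Ztilde_Z2 @^-1` V) \/
     exists (m : int) (t : 'Z_2) (N : nat), U = translate m @` zero_nbhd t N].

HB.instance Definition _ :=
  isSubBaseTopological.Build Ztilde Ztilde_subbase id.

(** The exponent is unique; [Int 0 t] is the only kind of point over an element
    of no [level n]. *)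
Definition phi (x : Ztilde) : 'Z_2 :=
  match x with
  | Int 0 t => t + 1
  | _ => (xget 0%N [set n | level n (Ztilde_Z2 x)]).+1%:R
  end.

(* Main.v *)
(* Neighbouring letters w(k-1), w(k) of the Thue-Morse sequence 0110... differ
   exactly when the 2-adic valuation of k is even. A bi-infinite word w has
   phase z when w(k-1) and w(k) differ exactly when z + k has even level, for
   all k with z + k <> 0. Every w in Omega has exactly one phase: if z - z' has
   level j, some k gives z + k and z' + k the levels j and j + 1, of opposite
   parities, so a finite window of w already determines z modulo 2^n, and the
   phases of its finite subwords, which are integers, converge. Conversely a
   word with a phase is in Omega, since iterated desubstitution brings its
   subwords down to length 2. The map pi sends w to its phase.

   A point of the extension of Z_2 says how w(k-1) and w(k) compare also when
   z + k = 0, so that w is recovered from it together with w(0): this is the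
   skew product, and w(1) - w(0) = phi(z + 1) is the cocycle.

   The vertices of the automaton are the words w(-1)w(0)w(1), and Theta(w) lists
   the digits of the phase and the vertices of the successive desubstitutions.
   One substitution doubles the radius of the window on which w is known, so
   n labels determine w on an interval around 0 that grows with n. *)

Require Import Defs.
From mathcomp Require Import all_boot all_order all_algebra.
From mathcomp Require Import all_classical topology.
From mathcomp Require Import zify ring.

Set Implicit Arguments.
Unset Strict Implicit.
Unset Printing Implicit Defensive.

Import GRing.Theory Num.Theory.
Local Open Scope classical_set_scope.
Local Open Scope ring_scope.

(** * The Thue-Morse sequence *)

(* [n + logn 2 n`!] is the sum of the [logn 2 j + 1] for [0 < j <= n], so that
   [tm] increases at [j] by the value of the cocycle at [j]. *)
Definition tm (n : nat) : bool := odd (n + logn 2 n`!).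

Lemma tmS n : tm n.+1 = tm n (+) ~~ odd (logn 2 n.+1).
Proof.
rewrite /tm factS lognM ?fact_gt0 // !oddD /=.
by case: (odd n); case: (odd (logn 2 n.+1)); case: (odd (logn 2 n`!)).
Qed.

Lemma logn2_odd n : odd n -> logn 2 n = 0%N.
Proof. by move=> no; rewrite lognE dvdn2 no andbF. Qed.

Lemma logn2_double n : (0 < n)%N -> logn 2 n.*2 = (logn 2 n).+1.
Proof. by move=> n0; rewrite -mul2n lognM. Qed.

Lemma tm_doubleS n : tm n.*2.+1 = ~~ tm n.*2.
Proof. by rewrite tmS logn2_odd ?addbT //= odd_double. Qed.

(** From 2n to 2n + 2 there is always a change at 2n + 1, and the valuation of 2n + 2 exceeds that
    of n + 1 by one; the two parity flips cancel. *)
Lemma tm_double n : tm n.*2 = tm n.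
Proof.
elim: n => // n IH; rewrite doubleS tmS tm_doubleS IH -doubleS logn2_double //.
by rewrite tmS /=; case: (tm n); case: (odd _).
Qed.

Lemma tm_half n : tm n = tm n./2 (+) odd n.
Proof.
rewrite -{1}(odd_double_half n); case: (odd n); last by rewrite tm_double addbF.
by rewrite add1n tm_doubleS tm_double addbT.
Qed.

Lemma zeta_tm m : zeta [seq tm k | k <- iota 0 m] = [seq tm k | k <- iota 0 m.*2].
Proof.
elim: m => // m IH; rewrite doubleS -[in LHS](addn1 m) iotaD map_cat /zeta map_cat.
rewrite flatten_cat -/(zeta _) IH -(addn2 m.*2) iotaD map_cat /= add0n.
by rewrite tm_doubleS tm_double.
Qed.

Lemma iter_zeta_tm n :
  iter n zeta [:: false] = [seq tm k | k <- iota 0 (2 ^ n)].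
Proof. by elim: n => //= n ->; rewrite zeta_tm expnS mul2n. Qed.

Lemma OmegaP (w : biword) :
  Omega w <-> forall (m : int) (l : nat), exists i : nat,
    forall k, (k < l)%N -> w (m + k%:Z) = tm (i + k).
Proof.
split=> Hw m l.
  have [n /infixP[p [s]]] := Hw m l; rewrite iter_zeta_tm => e.
  exists (size p) => k kl.
  have szl : size (subword w m l) = l by rewrite size_map size_iota.
  have h : (size p + k < 2 ^ n)%N.
    have := congr1 size e; rewrite size_map size_iota !size_cat szl => ->.
    by rewrite ltn_add2l ltn_addr.
  have := congr1 (fun s => nth false s (size p + k)) e.
  rewrite nth_cat ltnNge leq_addr /= addKn nth_cat szl kl.
  rewrite (nth_map 0%N) ?size_iota // nth_iota // add0n => ->.
  by rewrite (nth_map 0%N) ?size_iota // nth_iota.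
(* The prefix of length 2^(i + l) is long enough to contain the ranks i, ..., i + l - 1. *)
have [i Hi] := Hw m l; exists (i + l)%N; rewrite iter_zeta_tm.
have h : (i + l <= 2 ^ (i + l))%N by apply/ltnW/ltn_expl.
apply/infixP; exists [seq tm k | k <- iota 0 i].
exists [seq tm k | k <- iota (i + l) (2 ^ (i + l) - (i + l))].
rewrite -{1}(subnKC h) !iotaD !map_cat !add0n -!catA; congr (_ ++ (_ ++ _)).
rewrite /subword -{1}[i]addn0 iotaDl -map_comp; apply/eq_in_map => k.
by rewrite mem_iota /= add0n => kl; rewrite Hi.
Qed.

(** * Divisibility by powers of 2 in the 2-adic integers *)

Lemma residueM (x y : Z2) n : residue (x * y) n = residue x n * residue y n.
Proof. by []. Qed.

Lemma residueN (x : Z2) n : residue (- x) n = - residue x n.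
Proof. by []. Qed.

Lemma Zp_nat_eq0 n k : (k%:R == 0 :> 'Z_(2 ^ n.+1)) = (2 ^ n.+1 %| k)%N.
Proof. by rewrite -val_eqE /= val_Zp_nat ?pow2_gt1. Qed.

Lemma Zp_nat_eq n j k :
  (j%:R == k%:R :> 'Z_(2 ^ n.+1)) = (j == k %[mod 2 ^ n.+1])%N.
Proof. by rewrite -val_eqE /= !val_Zp_nat ?pow2_gt1. Qed.

Lemma residue_2exp_mul (m n : nat) (z : Z2) :
  (n < m)%N -> residue (2 ^+ m * z) n = 0.
Proof.
move=> nm; rewrite residueM -natrX residue_nat.
rewrite (_ : (2 ^ m)%:R = 0) ?mul0r //.
by apply/eqP; rewrite Zp_nat_eq0 dvdn_exp2l.
Qed.

(** Halving costs one binary digit: the residue modulo 2^(n + 2) fixes its half only modulo 2^(n +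
    1), whence the shift of index. *)
Lemma half_residue_coh (z : Z2) n :
  reduce (((residue z n.+2 : nat)./2)%:R : 'Z_(2 ^ n.+2)) =
  ((residue z n.+1 : nat)./2)%:R.
Proof.
rewrite reduce_nat -(residue_coh z n.+1) /reduce.
rewrite val_Zp_nat ?pow2_gt1 //; set a := (residue z _ : nat).
apply/eqP; rewrite Zp_nat_eq; apply/eqP.
rewrite (expnS 2 n.+1) -!divn2 {1}(divn_eq a (2 * 2 ^ n.+1)).
by rewrite mulnCA [X in (X + _)%N]mulnC divnMDl // modnMDl.
Qed.

Definition digit (z : Z2) : bool := odd (residue z 0).

Lemma Z2_halve (z : Z2) : exists u : Z2, z = (digit z : nat)%:R + 2 * u.
Proof.
exists (mkZ2 (half_residue_coh z)); rewrite /digit; apply: residueP => n.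
rewrite residueD residueM !residue_nat.
rewrite (_ : residue (mkZ2 _) n = ((residue z n.+1 : nat)./2)%:R) //.
have -> : residue z 0 = (residue z n.+1 : nat)%:R.
  elim: n => [|n IH]; first by rewrite -(residue_coh z 0).
  apply/eqP; rewrite IH -(residue_coh z n.+1) Zp_nat_eq /reduce.
  by rewrite val_Zp_nat ?pow2_gt1 // modn_dvdm // dvdn_exp2l.
rewrite -(residue_coh z n) /reduce -natrM -natrD val_Zp_nat ?pow2_gt1 //.
set a := (residue z _ : nat); apply/eqP; rewrite Zp_nat_eq; apply/eqP.
by rewrite modn2 oddb -{1}(odd_double_half a) -mul2n.
Qed.

Lemma Z2_expand (z : Z2) n :
  exists2 k : nat, (k < 2 ^ n)%N & exists u : Z2, z = k%:R + 2 ^+ n * u.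
Proof.
elim: n z => [|n IH] z; first by exists 0%N => //; exists z; rewrite add0r mul1r.
have [y ->] := Z2_halve z; have [k kn [u ->]] := IH y; set b := digit z.
exists (b + 2 * k)%N; first by rewrite expnS; case: (b); lia.
by exists u; rewrite natrD natrM exprS; ring.
Qed.

Lemma residue_eq0 (z : Z2) n : residue z n = 0 -> exists u, z = 2 ^+ n.+1 * u.
Proof.
have [k kn [u ->]] := Z2_expand z n.+1.
rewrite residueD residue_2exp_mul // addr0 residue_nat => /eqP.
rewrite Zp_nat_eq0; case: k kn => [|k] kn; first by exists u; rewrite add0r.
by rewrite gtnNdvd.
Qed.

Lemma level_residue n (z : Z2) : level n z <-> residue z n = (2 ^ n)%:R.
Proof.
split=> [[u ->]|h].
  rewrite mulrDr mulr1 residueD mulrA -exprSr residue_2exp_mul // add0r.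
  by rewrite -natrX residue_nat.
have [|u e] := @residue_eq0 (z - 2 ^+ n) n.
  by rewrite residueD residueN -natrX residue_nat h subrr.
by exists u; rewrite mulrDr mulr1 mulrA -exprSr -e subrK.
Qed.

Lemma level_uniq m n (z : Z2) : level m z -> level n z -> m = n.
Proof.
wlog mn : m n / (m <= n)%N => [W|].
  case/orP: (leq_total m n) => mn lm ln; first exact: W.
  by apply/esym/W.
move=> /level_residue lm [u zE]; apply/eqP; rewrite eqn_leq mn leqNgt /=.
apply/negP => mn'; move: lm; rewrite zE residue_2exp_mul // => /esym/eqP.
by rewrite Zp_nat_eq0 expnS -[X in (_ %| X)%N]mul1n dvdn_pmul2r // expn_gt0.
Qed.

Lemma not_level0 n : ~ level n 0.
Proof.
move=> /level_residue/eqP; rewrite eq_sym (_ : residue 0 n = 0%:R) // Zp_nat_eq0.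
by rewrite expnS -[X in (_ %| X)%N]mul1n dvdn_pmul2r // expn_gt0.
Qed.

Lemma level_near n (z z' : Z2) :
  residue z n = residue z' n -> level n z -> level n z'.
Proof. by move=> e /level_residue h; apply/level_residue; rewrite -e. Qed.

Lemma residue_le m n (z z' : Z2) :
  (m <= n)%N -> residue z n = residue z' n -> residue z m = residue z' m.
Proof.
move=> mn e; have [u uE] : exists u, z - z' = 2 ^+ n.+1 * u.
  by apply: residue_eq0; rewrite residueD residueN e subrr.
apply/eqP; rewrite -subr_eq0 -residueN -residueD uE; apply/eqP.
by rewrite residue_2exp_mul // ltnS.
Qed.

Lemma level_nat j : (0 < j)%N -> level (logn 2 j) j%:R.
Proof.
move=> j0; have := pfactor_coprime (isT : prime 2) j0 => -[m].
rewrite coprime2n => mo; set e := logn 2 j => ->; exists (m./2)%:R.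
by rewrite -{1}(odd_double_half m) mo natrM natrX natrD -mul2n natrM mulrC addrC.
Qed.

(** Modulo 2^(n + 1), [z] is a natural number [k] not divisible by 2^(n + 1); its valuation is at
    most n and is also the level of [z]. *)
Lemma level_residue_neq0 n (z : Z2) :
  residue z n != 0 -> exists2 j, (j <= n)%N & level j z.
Proof.
have [k kn [u ->]] := Z2_expand z n.+1.
rewrite residueD residue_2exp_mul // addr0 residue_nat Zp_nat_eq0 => kd.
have k0 : (0 < k)%N by case: k kd {kn}; rewrite ?dvdn0.
have jn : (logn 2 k <= n)%N.
  by rewrite leqNgt; apply: contra kd => /dvdn_exp2l/dvdn_trans->//; exact: pfactor_dvdnn.
exists (logn 2 k) => //; apply: level_near _ (level_nat k0).
by rewrite residueD residue_2exp_mul ?ltnS // addr0.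
Qed.

Lemma level_exists (z : Z2) : z <> 0 -> exists n, level n z.
Proof.
move=> z0; case: (pselect (exists n, residue z n != 0)) => [[n /level_residue_neq0[j]]|h].
  by exists j.
case: z0; apply: residueP => n; apply: contrapT => /eqP h'; apply: h.
by exists n.
Qed.

Lemma level_double n (z : Z2) : level n z -> level n.+1 (2 * z).
Proof. by move=> [u ->]; exists u; rewrite exprS mulrA. Qed.

Lemma level_odd (u : Z2) : level 0 (2 * u + 1).
Proof. by exists u; rewrite expr0 mul1r. Qed.

(** A nonzero integer has a level, its valuation, whereas 0 has none. *)
Lemma Z2_int_inj : injective (fun m : int => m%:~R : Z2).
Proof.
move=> m n /eqP; rewrite -subr_eq0 -rmorphB /= => /eqP h.
apply/eqP; rewrite -subr_eq0; case: (m - n) h => [[|j]|j] // h.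
  by have := @level_nat j.+1 isT; rewrite [_%:R]h => /not_level0.
move: h => /eqP; rewrite NegzE rmorphN oppr_eq0 => /eqP h.
by have := @level_nat j.+1 isT; rewrite [_%:R]h => /not_level0.
Qed.

(** * The 2-adic phase of a Thue-Morse word *)

Definition step (w : int -> bool) (k : int) : bool := w (k - 1) (+) w k.

Definition agree (R : nat) (w w' : int -> bool) : Prop :=
  forall k : int, (`|k| <= R)%N -> w k = w' k.

Definition phase_on (R : nat) (w : int -> bool) (z : Z2) : Prop :=
  forall (k : int) n, (`|k| <= R)%N -> level n (z + k%:~R) -> step w k = ~~ odd n.

Definition phase (w : int -> bool) (z : Z2) : Prop :=
  forall (k : int) n, level n (z + k%:~R) -> step w k = ~~ odd n.

Lemma phase_phase_on R w z : phase w z -> phase_on R w z.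
Proof. by move=> h k n _; apply: h. Qed.

(* If [z] and [z'] differ by an element of level [j], there is a translate for
   which they have levels [j] and [j + 1], of different parities. *)
Lemma phase_on_residue n R w w' z z' : (2 ^ n.+3 <= R)%N -> agree R w w' ->
  phase_on R w z -> phase_on R w' z' -> residue z n = residue z' n.
Proof.
move=> nR ww' hz hz'; apply/eqP/negPn/negP => zz'.
have [|j jn [u uE]] := @level_residue_neq0 n (z - z').
  by rewrite residueD residueN subr_eq0.
have [r r_lt [v vE]] := Z2_expand z' j.+2.
(* Modulo 2^(j + 2), [k] is 2^(j + 1) - z', so that z' + k has level j + 1; adding z - z', of level
   j, gives z + k level j. Moreover k < 2^(j + 3), which explains the bound on [R]. *)
pose k := (2 ^ j.+1 + (2 ^ j.+2 - r))%N.
have kR : (k < R)%N.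
  apply: leq_trans nR; apply: (@leq_trans (2 ^ j.+3)%N); last by rewrite leq_exp2l.
  by rewrite /k !expnS; have := expn_gt0 2 j; rewrite /= in r_lt *; lia.
have kE : k%:R = 2 ^+ j.+1 + (2 ^+ j.+2 - r%:R) :> Z2.
  by rewrite natrD natrB 1?ltnW // !natrX.
have l' : level j.+1 (z' + k%:Z%:~R).
  exists (v + 1); rewrite vE -[_%:~R]/(k%:R) kE !exprS; ring.
have l : level j (z + k%:Z%:~R).
  exists (u + 2 * (v + 1) + 1); rewrite -[z](subrK z') uE vE -[_%:~R]/(k%:R) kE.
  rewrite !exprS; ring.
have := hz k j (ltnW kR) l; have := hz' k j.+1 (ltnW kR) l'.
rewrite /step !ww' ?(ltnW kR) //= => [->|]; first by case: (odd j).
by case: k kR {kE l l'} => [|k]; lia.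
Qed.

Lemma phase_uniq w z z' : phase w z -> phase w z' -> z = z'.
Proof.
move=> hz hz'; apply: residueP => n.
by apply: (@phase_on_residue n _ w w _ _ (leqnn _)) => //; apply: phase_phase_on.
Qed.

Lemma Omega_phase_on (w : biword) (L : nat) :
  Omega w -> exists z, phase_on L w z.
Proof.
move=> /OmegaP /(_ (- L.+1%:Z) (L.+1 + L.+1)%N)[i Hi].
(* The window starts at -(L + 1), since the step at -L looks one letter to the left. Position k then
   has rank i + L + 1 + k in [tm], and this rank is positive. *)
exists (i + L.+1)%:R => k n kL.
have [j [kE j0 jL]] : exists j : nat,
    [/\ k = - L.+1%:Z + j%:Z, (0 < j)%N & (j < L.+1 + L.+1)%N].
  by exists (absz (k + L.+1%:Z)); split; lia.
have -> : (i + L.+1)%:R + k%:~R = (i + j)%:R :> Z2.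
  by rewrite kE !natrD rmorphD rmorphN /=; ring.
have ij0 : (0 < i + j)%N by lia.
move=> /level_uniq - /(_ _ (level_nat ij0)) ->.
rewrite /step kE Hi // (_ : - L.+1%:Z + j%:Z - 1 = - L.+1%:Z + j.-1%:Z); last by lia.
rewrite Hi; last by lia.
rewrite -{2 3}(prednK j0) addnS tmS.
by rewrite addKb.
Qed.

Lemma Omega_phase (w : biword) : Omega w -> exists z, phase w z.
Proof.
move=> /Omega_phase_on h; have [f fP] := choice h.
(* Beyond radius 2^(n + 3) the residues of the approximate phases modulo 2^(n + 1) are constant;
   they assemble into the limit. *)
pose r n := residue (f (2 ^ n.+3)%N) n.
have on_le L L' z : (L <= L')%N -> phase_on L' w z -> phase_on L w z.
  by move=> LL' hz k n kL; apply: hz; exact: leq_trans LL'.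
have rP n L : (2 ^ n.+3 <= L)%N -> residue (f L) n = r n.
  move=> nL; apply: (@phase_on_residue n (2 ^ n.+3)%N w w) => //.
  exact: on_le (fP L).
have rC n : reduce (r n.+1) = r n by rewrite residue_coh rP // leq_exp2l.
exists (mkZ2 rC) => k n zk; pose L := (2 ^ n.+3 + `|k|)%N.
apply: (fP L k n); first by rewrite leq_addl.
apply: level_near zk; rewrite !residueD rP ?leq_addr //.
Qed.

(** * Substitution and desubstitution *)

(** This is [zeta] on bi-infinite words, the block of the letter w(q) being placed at 2q - b and 2q
    + 1 - b. *)
Definition subst (b : bool) (w : int -> bool) : int -> bool :=
  fun k => w ((k + (b : nat)%:Z) %/ 2)%Z (+) odd (absz (k + (b : nat)%:Z)).

Definition desubst (b : bool) (w : int -> bool) : int -> bool :=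
  fun k => w (2 * k - (b : nat)%:Z).

Lemma int_split (b : bool) (k : int) :
  exists (q : int) (r : bool), k = 2 * q + (r : nat)%:Z - (b : nat)%:Z.
Proof.
exists ((k + (b : nat)%:Z) %/ 2)%Z, (odd (absz (k + (b : nat)%:Z))); lia.
Qed.

Lemma substE (b r : bool) w q :
  subst b w (2 * q + (r : nat)%:Z - (b : nat)%:Z) = w q (+) r.
Proof. by rewrite /subst; congr (w _ (+) _); lia. Qed.

Lemma desubstK b w k : desubst b (subst b w) k = w k.
Proof. by rewrite /desubst -(addr0 (2 * k)) (substE b false) addbF. Qed.

Lemma Z2_translate_split (b r : bool) (z : Z2) (q : int) :
  (b : nat)%:R + 2 * z + (2 * q + (r : nat)%:Z - (b : nat)%:Z)%:~R =
  2 * (z + q%:~R) + (r : nat)%:R.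
Proof. by rewrite rmorphB rmorphD rmorphM /=; ring. Qed.

Lemma level_halve n (z : Z2) : level n (2 * z) -> exists2 m, n = m.+1 & level m z.
Proof.
move=> l; case: (pselect (z = 0)) l => [->|/level_exists[m lm]] l.
  by move: l; rewrite mulr0 => /not_level0.
by exists m => //; apply: level_uniq l (level_double lm).
Qed.

(** The two positions form a block of the substitution: the translate of the phase to the second one
    is odd, hence of level 0, which forces a change. *)
Lemma phase_odd (b : bool) w z (q : int) : phase w ((b : nat)%:R + 2 * z) ->
  w (2 * q + 1 - (b : nat)%:Z) = ~~ w (2 * q - (b : nat)%:Z).
Proof.
move=> hw; have := hw (2 * q + 1 - (b : nat)%:Z) 0%N.
rewrite (Z2_translate_split b true) => /(_ (level_odd _)).
rewrite /step (_ : _ - 1 = 2 * q - (b : nat)%:Z); last by lia.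
by case: (w _); case: (w _).
Qed.

Lemma substK (b : bool) w z : phase w ((b : nat)%:R + 2 * z) ->
  forall k, subst b (desubst b w) k = w k.
Proof.
move=> hw k; have [q [[] ->]] := int_split b k; rewrite substE /desubst.
  by rewrite addbT (phase_odd _ hw).
by rewrite addbF addr0.
Qed.

(** Passing from one block start to the next crosses a block, which changes the letter, and a
    boundary of level n + 1. The change flips the parity, as required for level n. *)
Lemma phase_desubst (b : bool) w z :
  phase w ((b : nat)%:R + 2 * z) -> phase (desubst b w) z.
Proof.
move=> hw k n /level_double l.
have := hw (2 * k + 0 - (b : nat)%:Z) n.+1.
rewrite (Z2_translate_split b false) addr0 => /(_ l); rewrite /step /desubst /=.
rewrite addr0 (_ : _ - 1 = 2 * (k - 1) + 1 - (b : nat)%:Z); last by lia.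
rewrite (phase_odd _ hw) negbK => <-.
by case: (w _); case: (w _).
Qed.

Lemma phase_subst (b : bool) w z :
  phase w z -> phase (subst b w) ((b : nat)%:R + 2 * z).
Proof.
move=> hw k n; have [q [r ->]] := int_split b k.
rewrite Z2_translate_split /step; case: r => l.
  rewrite (level_uniq l (level_odd _)) (_ : _ - 1 = 2 * q + 0 - (b : nat)%:Z); last by lia.
  by rewrite (substE b false) (substE b true); case: (w q).
move: l; rewrite addr0 => /level_halve[m -> l] /=.
rewrite (_ : _ - 1 = 2 * (q - 1) + 1 - (b : nat)%:Z); last by lia.
rewrite (substE b true) (substE b false) -(hw _ _ l) /step.
by rewrite addbT addbF addNb.
Qed.

(** A window of length at most 2^(n + 1) + 1 meets at most 2^n + 1 blocks, so desubstitution lowers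
    [n] by one, until only length 2 is left. *)
Lemma phase_window n (w : int -> bool) z (m : int) l :
  phase w z -> (l <= (2 ^ n).+1)%N ->
  exists i : nat, forall k, (k < l)%N -> w (m + k%:Z) = tm (i + k).
Proof.
elim: n w z m l => [|n IH] w z m l hw lb.
  suff [i [i0 i1]] : exists i, tm i = w (m + 0) /\ tm i.+1 = w (m + 1).
    exists i => -[|[|k]] kl; rewrite ?addn0 ?addn1 //.
    by have := leq_trans kl lb.
  have t1 : tm 1 = true by rewrite tm_half.
  have t2 : tm 2 = true by rewrite -[2%N]/(1.*2)%N tm_double t1.
  have t3 : tm 3 = false by rewrite -[3%N]/(1.*2.+1)%N tm_doubleS tm_double t1.
  have t5 : tm 5 = false by rewrite -[5%N]/(2.*2.+1)%N tm_doubleS tm_double t2.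
  have t6 : tm 6 = false by rewrite -[6%N]/(3.*2)%N tm_double t3.
  (* The words 11, 10, 01 and 00 occur in 0110100... at ranks 1, 2, 0 and 5. *)
  case: (w _); case: (w _).
  - by exists 1%N.
  - by exists 2%N.
  - by exists 0%N.
  - by exists 5%N.
have [u zE] := Z2_halve z; rewrite zE in hw; move: (digit z) hw => b hw.
have [q [r mE]] := int_split b m.
have [i Hi] := IH _ _ q (2 ^ n).+1 (phase_desubst hw) (leqnn _).
exists (i.*2 + r)%N => k kl.
rewrite -(substK hw) mE tm_half.
have -> : 2 * q + (r : nat)%:Z - (b : nat)%:Z + k%:Z =
    2 * (q + ((r + k)./2)%:Z) + (odd (r + k) : nat)%:Z - (b : nat)%:Z by lia.
rewrite substE Hi; last by move: kl lb; rewrite expnS; case: r {mE}; lia.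
by congr (tm _ (+) _); lia.
Qed.

Lemma phase_Omega (w : biword) z : phase w z -> Omega w.
Proof.
move=> hw; apply/OmegaP => m l; apply: (@phase_window l w z m l hw).
by rewrite ltnW // ltnW // ltnS ltn_expl.
Qed.

(** * Words with a prescribed phase *)

Lemma F2_bool (t : 'Z_2) : t = (t == 1 : nat)%:R.
Proof. by apply: val_inj; case: t => [[|[|]]]. Qed.

Lemma F2_eq1D (t u : 'Z_2) : (t + u == 1) = (t == 1) (+) (u == 1).
Proof. by rewrite (F2_bool t) (F2_bool u); case: (t == 1); case: (u == 1). Qed.

Lemma F2_eq1_inj (t u : 'Z_2) : (t == 1) = (u == 1) -> t = u.
Proof. by move=> e; rewrite (F2_bool t) (F2_bool u) e. Qed.

Lemma F2_nat_eq1 n : (n%:R == 1 :> 'Z_2) = odd n.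
Proof. by elim: n => // n IH; rewrite -natr1 F2_eq1D IH addbT. Qed.

Lemma phi_level n x : level n (Ztilde_Z2 x) -> phi x = n.+1%:R.
Proof.
move=> l; have xE : xget 0%N [set n | level n (Ztilde_Z2 x)] = n.
  by apply: xget_unique => // m lm; apply: level_uniq lm l.
by case: x l xE => [z|[[|m]|m] t] l; rewrite /phi;
  [move=> ->|case/not_level0: l|move=> ->..].
Qed.

Lemma Ztilde_Z2_translate m x :
  Ztilde_Z2 (translate m x) = Ztilde_Z2 x + m%:~R.
Proof. by case: x => //= n t; rewrite rmorphD. Qed.

Lemma translateD m n x : translate m (translate n x) = translate (n + m) x.
Proof.
case: x => [z|k t] /=; last by rewrite addrA.
by congr Nonint; apply: val_inj; rewrite /= rmorphD addrA.
Qed.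

Lemma translate0 x : translate 0 x = x.
Proof.
case: x => [z|k t] /=; last by rewrite addr0.
by congr Nonint; apply: val_inj; rewrite /= addr0.
Qed.

Definition cumul (d : int -> 'Z_2) (k : int) : 'Z_2 :=
  match k with
  | Posz n => \sum_(j < n) d j.+1%:Z
  | Negz n => \sum_(j < n.+1) d (- j%:Z)
  end.

Lemma cumul0 d : cumul d 0 = 0.
Proof. exact: big_ord0. Qed.

Lemma F2_addK (t u : 'Z_2) : t + u + u = t.
Proof.
by rewrite (F2_bool t) (F2_bool u); case: (t == 1); case: (u == 1); apply: val_inj.
Qed.

Lemma cumul_step d k : cumul d k = cumul d (k - 1) + d k.
Proof.
case: k => [[|n]|n].
- by rewrite [LHS]cumul0 /= big_ord_recr big_ord0 /= add0r -{1}(F2_addK 0 (d 0)) add0r.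
- by rewrite (_ : n.+1%:Z - 1 = n%:Z) /= ?big_ord_recr //; lia.
rewrite (_ : Negz n - 1 = Negz n.+1) /= ?(big_ord_recr n.+1); last by lia.
by rewrite (_ : - n.+1%:Z = Negz n) /= ?F2_addK //; lia.
Qed.

Lemma step_ext (w w' : int -> bool) :
  w 0 = w' 0 -> (forall k, step w k = step w' k) -> forall k, w k = w' k.
Proof.
move=> e0 e; rewrite /step in e.
have e' k : (w (k - 1) == w' (k - 1)) = (w k == w' k).
  by have := e k; case: (w _); case: (w k); case: (w' _); case: (w' k).
case=> n; apply/eqP.
  elim: n => [|n IH]; first by rewrite e0.
  by rewrite -e' (_ : n.+1%:Z - 1 = n%:Z) //; lia.
elim: n => [|n IH]; first by rewrite (_ : Negz 0 = 0 - 1) // e' e0.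
by rewrite (_ : Negz n.+1 = Negz n - 1) ?e' //; lia.
Qed.

(** The inverse of the skew product coding: the letter at 0 is [s] and the increments are the
    cocycle along the orbit of [x]. *)
Definition word (s : 'Z_2) (x : Ztilde) : biword :=
  fun k => s + cumul (fun j => phi (translate j x)) k == 1.

Lemma word0 s x : word s x 0 = (s == 1).
Proof. by rewrite /word cumul0 addr0. Qed.

Lemma step_word s x k : step (word s x) k = (phi (translate k x) == 1).
Proof. by rewrite /step /word (cumul_step _ k) addrA !F2_eq1D addKb. Qed.

Lemma phase_word s x : phase (word s x) (Ztilde_Z2 x).
Proof.
move=> k n; rewrite -Ztilde_Z2_translate step_word => /phi_level ->.
by rewrite F2_nat_eq1.
Qed.

Definition Omega_word (s : 'Z_2) (x : Ztilde) : Omega :=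
  exist _ (word s x) (mem_set (phase_Omega (@phase_word s x))).

Lemma Omega_ext (w w' : Omega) : (forall k, val w k = val w' k) -> w = w'.
Proof. by move=> e; apply/val_inj/funext. Qed.

Lemma sigma_word s x :
  sigma (Omega_word s x) =
  Omega_word (s + phi (translate 1 x)) (translate 1 x).
Proof.
apply: Omega_ext => /=; apply: step_ext => [|k].
  by rewrite word0 /shift /= /word (cumul_step _ 1) subrr cumul0 add0r.
rewrite step_word translateD -(step_word s) /step /shift.
by congr (word s x _ (+) word s x _); lia.
Qed.

Definition phase_of (w : Omega) : Z2 := xget 0 [set z | phase (val w) z].

Lemma phase_ofP (w : Omega) : phase (val w) (phase_of w).
Proof.
apply: (@xgetPex _ 0 [set z | phase (val w) z]).
exact/Omega_phase/set_mem/valP.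
Qed.

Lemma phase_of_eq (w : Omega) z : phase (val w) z -> phase_of w = z.
Proof. by move=> hz; exact: (phase_uniq (@phase_ofP w) hz). Qed.

Lemma phase_of_word s x : phase_of (Omega_word s x) = Ztilde_Z2 x.
Proof. exact/phase_of_eq/phase_word. Qed.

Lemma phase_of_sigma w : phase_of (sigma w) = phase_of w + 1.
Proof.
apply: phase_of_eq => k n; rewrite -addrA -(intrD _ 1 k) => l.
rewrite -(phase_ofP l) /step /= /shift.
by congr (_ (+) _); congr (val w); lia.
Qed.

(** The phase dictates every step except the one at k = -z when z is an integer; the branch of the
    point over z is there to record that step. *)
Lemma Omega_word_surj (w : Omega) : exists s x, Omega_word s x = w.
Proof.
pose z := phase_of w; have zP : phase (val w) z := @phase_ofP w.
pose s : 'Z_2 := (val w 0 : nat)%:R.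
suff [x [xz xP]] : exists x, Ztilde_Z2 x = z /\
    forall k, z + k%:~R = 0 -> step (val w) k = (phi (translate k x) == 1).
  exists s, x; apply/Omega_ext/step_ext => [|k].
    by rewrite /= word0 F2_nat_eq1 oddb.
  rewrite step_word; case: (pselect (z + k%:~R = 0)) => [/xP //|/level_exists[n l]].
  rewrite (zP _ _ l) (@phi_level n (translate k x)) ?F2_nat_eq1 //.
  by rewrite Ztilde_Z2_translate xz.
case: (pselect (ZinZ2 z)) => [[m zm]|zn]; last first.
  exists (Nonint (exist _ z (mem_set (zn : (~` ZinZ2) z)))); split=> // k zk.
  case: zn; exists (- k); rewrite rmorphN; apply/eqP.
  by rewrite -addr_eq0 zk.
(* Since phi(0, t) = t + 1, the branch is the step plus 1. *)
exists (Int m ((step (val w) (- m) : nat)%:R + 1)); split=> // k.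
rewrite zm -rmorphD => /(@Z2_int_inj _ 0) mk0 /=; rewrite mk0.
have -> : k = - m by lia.
by rewrite !F2_eq1D F2_nat_eq1 oddb; case: (step _ _).
Qed.

Lemma Omega_word_inj s x s' x' :
  Omega_word s x = Omega_word s' x' -> s = s' /\ x = x'.
Proof.
move=> e; have ez : Ztilde_Z2 x = Ztilde_Z2 x'.
  by rewrite -(phase_of_word s) e phase_of_word.
have {e} e : word s x = word s' x' := congr1 val e.
split; first by apply: F2_eq1_inj; rewrite -(word0 s x) e word0.
have eP k : phi (translate k x) = phi (translate k x').
  by apply: F2_eq1_inj; rewrite -(step_word s) e step_word.
case: x x' ez eP {e} => [z|m t] [z'|m' t'] /= ez eP.
- by congr Nonint; apply: val_inj.
- by case: (set_mem (valP z)); exists m'.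
- by case: (set_mem (valP z')); exists m.
move: ez => /Z2_int_inj mm; rewrite -mm in eP *.
(* Translation by -m moves both points over 0, where the cocycle reads off the branch. *)
by have := eP (- m); rewrite subrr => /addIr ->.
Qed.

(** * Topology of the spaces of words, paths and 2-adic integers *)

Section ProductSubspace.
Context {I : eqType} {K : I -> topologicalType} {A : set (prod_topology K)}.

(** The topology is the initial one for the coordinates, so it is enough that each coordinate be
    locally constant. *)
Lemma continuous_subspace_coord {X : topologicalType} (f : X -> A) :
  (forall x i, nbhs x [set y | (val (f y) : prod_topology K) i =
                               (val (f x) : prod_topology K) i]) ->
  continuous f.
Proof.
move=> H x; pose g (y : X) : prod_topology K := val (f y).
have gx : g @ x --> g x.
  apply/cvg_sup => i U [B [[C oC <-] Bz BU]].
  apply: filterS (H x i) => y e; apply: BU.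
  by move: Bz; rewrite /= -[g x i]/((val (f x) : prod_topology K) i) -e.
move=> U [B [[C oC <-] Bz BU]].
have : \forall y \near x, C (g y) by apply: gx; apply: open_nbhs_nbhs.
by apply: filterS => y Cy; apply: BU.
Qed.

Lemma nbhs_subspace_coord (w : A) i :
  nbhs ((val w : prod_topology K) i) [set (val w : prod_topology K) i] ->
  nbhs w [set w' : A | (val w' : prod_topology K) i = (val w : prod_topology K) i].
Proof.
move=> h.
apply: (@continuous_comp A _ _ (fun y : A => (val y : prod_topology K))
         (fun f => f i) w _ _ _ h).
  exact: (@initial_continuous _ _ (fun y : A => (val y : prod_topology K))).
exact: (@proj_continuous _ K i).
Qed.

End ProductSubspace.

Lemma nbhs_Omega_agree (w : Omega) R : nbhs w [set w' : Omega | agree R (val w) (val w')].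
Proof.
have h (k : int) : nbhs w [set w' : Omega | val w' k = val w k].
  by apply: (@nbhs_subspace_coord _ (fun _ : int => bool)); exact: discrete_set1.
elim: R => [|R IH].
  by apply: filterS (h 0) => w' /= e k k0; rewrite (_ : k = 0) ?e //; lia.
apply: filterS (filterI IH (filterI (h R.+1%:Z) (h (- R.+1%:Z)))) => w' /= [e [e1 e2]] k kR.
case: (leqP `|k| R) => [/e //|Rk].
by have [->|->] : k = R.+1%:Z \/ k = - R.+1%:Z by lia.
Qed.

Lemma discrete_label (a : label) : nbhs a [set a].
Proof.
case: a => b v; exists ([set b], [set v]); first by split; exact: discrete_set1.
by move=> [b' v'] /= [-> ->].
Qed.

Lemma nbhs_LA_prefix (p : LA) n :
  nbhs p [set q : LA | forall k, (k < n)%N -> val q k = val p k].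
Proof.
elim: n => [|n IH]; first by apply: filterS filterT.
have h : nbhs p [set q : LA | val q n = val p n].
  by apply: (@nbhs_subspace_coord _ (fun _ : nat => label)); exact: discrete_label.
apply: filterS (filterI IH h) => q /= [e e'] k; rewrite ltnS leq_eqVlt.
by case/orP => [/eqP->|/e].
Qed.

Lemma nbhs_Z2_residue (z : Z2) n : nbhs z [set z' | residue z' n = residue z n].
Proof. exact: (@residue_continuous n z _ (discrete_set1 (residue z n))). Qed.

Lemma continuous_Z2 {X : topologicalType} (f : X -> Z2) :
  (forall x n, nbhs x [set y | residue (f y) n = residue (f x) n]) -> continuous f.
Proof. exact: (@continuous_subspace_coord _ _ coherent). Qed.

Lemma continuous_Omega {X : topologicalType} (f : X -> Omega) :
  (forall x k, nbhs x [set y | val (f y) k = val (f x) k]) -> continuous f.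
Proof. exact: (@continuous_subspace_coord _ (fun _ : int => bool) Omega). Qed.

Lemma continuous_LA {X : topologicalType} (f : X -> LA) :
  (forall x n, nbhs x [set y | val (f y) n = val (f x) n]) -> continuous f.
Proof. exact: (@continuous_subspace_coord _ (fun _ : nat => label) LA). Qed.

(** * The homeomorphism with the skew product *)

Lemma subbase_open (U : set Ztilde) : Ztilde_subbase U -> open U.
Proof.
move=> sU; exists [set U]; last by rewrite bigcup_set1.
by move=> _ ->; apply: (@finI_from1 _ _ _ (@id (set Ztilde))).
Qed.

Lemma cvg_subbase (F : set_system Ztilde) (x : Ztilde) : Filter F ->
  (forall U, Ztilde_subbase U -> U x -> F U) -> F --> x.
Proof.
move=> FF H U; rewrite nbhsE => -[B [[D sD <-] [V DV Vx]] BU].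
have [E sE VE] := sD _ DV; apply: (@filterS _ F _ V).
  by move=> y Vy; apply: BU; exists V.
rewrite -VE in Vx *; apply: filter_bigI => W WE; apply: H; last exact: Vx.
by have := sE _ WE; rewrite inE.
Qed.

Lemma Ztilde_Z2_continuous : continuous Ztilde_Z2.
Proof.
move=> x U; rewrite nbhsE => -[B [oB Bx] BU].
have oB' : open (Ztilde_Z2 @^-1` B) by apply: subbase_open; left; exists B.
by apply: (@filterS _ _ _ (Ztilde_Z2 @^-1` B)) => [y /BU //|]; apply: open_nbhs_nbhs.
Qed.

Lemma Ztilde_Z2_eq0 x : Ztilde_Z2 x = 0 -> exists t, x = Int 0 t.
Proof.
case: x => [z|m t] /= h; first by case: (set_mem (valP z)); exists 0.
by exists t; rewrite (@Z2_int_inj m 0).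
Qed.

Lemma F2_nat_ord (t : 'Z_2) : (t : nat) = (t == 1).
Proof. by case: t => [[|[|]]]. Qed.

(** All levels 2n + t have the parity of [t]: the topology separates the two points over 0 exactly
    so that the cocycle becomes continuous there. *)
Lemma zero_nbhd_phi t N x : zero_nbhd t N x -> phi x = t + 1.
Proof.
case=> [-> //|[n _ /phi_level ->]]; apply: F2_eq1_inj.
rewrite F2_nat_eq1 F2_eq1D F2_nat_ord eqxx addbT /= oddD mul2n odd_double.
by case: (t == 1).
Qed.

Lemma translateNK m x : translate m (translate (- m) x) = x.
Proof. by rewrite translateD addNr translate0. Qed.

Lemma translateK m x : translate (- m) (translate m x) = x.
Proof. by rewrite translateD addrN translate0. Qed.

Lemma near_phi_translate (x : Ztilde) (j : int) :
  nbhs x [set y | phi (translate j y) = phi (translate j x)].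
Proof.
case: (pselect (Ztilde_Z2 (translate j x) = 0)) => [/Ztilde_Z2_eq0[t e]|].
  pose U := translate (- j) @` zero_nbhd t 0.
  have Ux : U x by exists (Int 0 t); [left|rewrite -e translateK].
  have oU : open U by apply: subbase_open; right; exists (- j), t, 0%N.
  have : nbhs x U by apply: open_nbhs_nbhs.
  apply: filterS => _ [y yU <-] /=; rewrite translateNK e.
  exact: zero_nbhd_phi yU.
move=> /level_exists[n l]; rewrite (phi_level l).
have : nbhs x [set y | residue (Ztilde_Z2 y) n = residue (Ztilde_Z2 x) n].
  exact: Ztilde_Z2_continuous (nbhs_Z2_residue (Ztilde_Z2 x) n).
apply: filterS => y /= e; apply: phi_level; apply: level_near l.
by rewrite !Ztilde_Z2_translate !residueD e.
Qed.

Lemma near_phi_translates (x : Ztilde) n :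
  nbhs x [set y | forall j : int, (`|j| <= n)%N ->
    phi (translate j y) = phi (translate j x)].
Proof.
elim: n => [|n IH].
  apply: filterS (near_phi_translate x 0) => y /= e j j0.
  by rewrite (_ : j = 0) //; lia.
apply: filterS (filterI IH (filterI (near_phi_translate x n.+1%:Z)
  (near_phi_translate x (- n.+1%:Z)))) => y /= [e [e1 e2]] j jn.
case: (leqP `|j| n) => [/e //|nj].
by have [->|->] : j = n.+1%:Z \/ j = - n.+1%:Z by lia.
Qed.

Lemma cumul_local (d d' : int -> 'Z_2) k :
  (forall j : int, (`|j| <= `|k|)%N -> d j = d' j) -> cumul d k = cumul d' k.
Proof.
by case: k => k /= e; apply: eq_bigr => i _; apply: e; have := ltn_ord i; lia.
Qed.

Lemma Omega_word_continuous :
  continuous (fun p : 'Z_2 * Ztilde => Omega_word p.1 p.2).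
Proof.
apply: continuous_Omega => -[s x] k.
exists ([set s], [set y | forall j : int, (`|j| <= `|k|)%N ->
    phi (translate j y) = phi (translate j x)]) => /=.
  by split; [exact: discrete_set1|exact: near_phi_translates].
move=> [s' y] /= [-> e]; rewrite /word; congr (_ + _ == 1).
by apply: cumul_local => j /e.
Qed.

Lemma phase_of_local n (w w' : Omega) : agree (2 ^ n.+3) (val w) (val w') ->
  residue (phase_of w) n = residue (phase_of w') n.
Proof.
by move=> /phase_on_residue; apply=> //; apply: phase_phase_on; apply: phase_ofP.
Qed.

Lemma phase_of_continuous : continuous phase_of.
Proof.
apply: continuous_Z2 => w n; apply: filterS (nbhs_Omega_agree w (2 ^ n.+3)).
by move=> w' /phase_of_local.
Qed.

Lemma Omega_word_bij (w : Omega) :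
  exists p : 'Z_2 * Ztilde, Omega_word p.1 p.2 = w.
Proof. by have [s [x e]] := Omega_word_surj w; exists (s, x). Qed.

Definition Psi (w : Omega) : 'Z_2 * Ztilde := projT1 (cid (Omega_word_bij w)).

Lemma PsiK (w : Omega) : Omega_word (Psi w).1 (Psi w).2 = w.
Proof. exact: (projT2 (cid (Omega_word_bij w))). Qed.

Lemma Psi_word s x : Psi (Omega_word s x) = (s, x).
Proof.
by have /Omega_word_inj[] := PsiK (Omega_word s x); case: (Psi _) => ? ? /= -> ->.
Qed.

Lemma Ztilde_Z2_Psi w : Ztilde_Z2 (Psi w).2 = phase_of w.
Proof. by rewrite -{2}(PsiK w) phase_of_word. Qed.

Lemma step_Psi (w : Omega) k : step (val w) k = (phi (translate k (Psi w).2) == 1).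
Proof. by rewrite -{1}(PsiK w) step_word. Qed.

(** The cocycle fixes the branch of [y], or else the parity of its level, and the residue excludes
    levels below 2N + t. Both data can be read from a finite window of a word, which yields the
    continuity of [Psi]. *)
Lemma zero_nbhd_near (t : 'Z_2) N (x y : Ztilde) :
  phi x = phi y -> residue (Ztilde_Z2 x) (2 * N + t) = residue (Ztilde_Z2 y) (2 * N + t) ->
  zero_nbhd t N x -> zero_nbhd t N y.
Proof.
move=> exy rxy xN; have px := zero_nbhd_phi xN.
case: (pselect (Ztilde_Z2 y = 0)) => [/Ztilde_Z2_eq0[t' yE]|/level_exists[j lj]].
  by left; move: exy; rewrite px yE /= => /addIr <-.
have jt : odd j = (t : nat) :> nat.
  have := px; rewrite exy (phi_level lj) -natr1 => /addIr <-.
  by rewrite F2_nat_ord F2_nat_eq1.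
right; exists j./2; last by rewrite mul2n -jt addnC odd_double_half.
rewrite leqNgt; apply/negP => jN.
have {}jN : (j < 2 * N + t)%N by rewrite -jt; lia.
have lx : level j (Ztilde_Z2 x).
  by apply: level_near lj; apply/esym/(residue_le (ltnW jN)).
case: xN => [xE|[n Nn /(level_uniq lx) jE]]; last by lia.
by move: lx; rewrite xE => /not_level0.
Qed.

Lemma Psi_continuous : continuous Psi.
Proof.
have Psi1 : continuous (fun w => (Psi w).1).
  move=> w U U1.
  apply: filterS (nbhs_Omega_agree w 0) => w' /= /(_ 0 isT).
  rewrite -{1}(PsiK w) -{1}(PsiK w') /= !word0 => /F2_eq1_inj e.
  by rewrite -e; exact: nbhs_singleton.
have Psi2 (w : Omega) : (Psi v).2 @[v --> w] --> (Psi w).2.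
  have FF : Filter ((Psi v).2 @[v --> w]) by exact: (fmap_filter _ (nbhs_filter w)).
  apply: cvg_subbase => U sU xU; change (nbhs w [set w' | U (Psi w').2]).
  case: sU xU => [[V oV ->]|[m [t [N ->]]]] /= xU.
    rewrite /= Ztilde_Z2_Psi in xU.
    have : nbhs w [set w' | V (phase_of w')].
      by apply: phase_of_continuous; apply: open_nbhs_nbhs.
    by apply: filterS => w'; rewrite /= Ztilde_Z2_Psi.
  case: xU => y yN yx.
  pose n := (2 * N + (t : nat))%N.
  (* Radius 2^(n + 3) determines the residue modulo 2^(n + 1), and |m| + 1 covers the letters at -m
     - 1 and -m that give the cocycle. *)
  apply: filterS (nbhs_Omega_agree w (2 ^ n.+3 + `|m|.+1)%N) => w' ww' /=.
  exists (translate (- m) (Psi w').2); last by rewrite translateNK.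
  apply: zero_nbhd_near yN; rewrite -[y](translateK m) yx.
    by apply: F2_eq1_inj; rewrite -!step_Psi /step !ww' //; lia.
  rewrite !Ztilde_Z2_translate !Ztilde_Z2_Psi !residueD; congr (_ + _).
  apply: phase_of_local => k kn; apply: ww'.
  by apply: leq_trans kn _; rewrite leq_addr.
have -> : Psi = fun w => ((Psi w).1, (Psi w).2).
  by apply/funext => v; case: (Psi v).
by move=> w; exact: cvg_pair (Psi1 w) (Psi2 w).
Qed.

(** * The path of a Thue-Morse word *)

Lemma digit_double (b : bool) (u : Z2) : digit ((b : nat)%:R + 2 * u) = b.
Proof.
rewrite /digit residueD -{1}(expr1 2) residue_2exp_mul // addr0 residue_nat.
by case: b.
Qed.

Lemma phase_of_halve (w : Omega) :
  exists u, phase (val w) ((digit (phase_of w) : nat)%:R + 2 * u).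
Proof.
have [u e] := Z2_halve (phase_of w); exists u; rewrite -e; exact: phase_ofP.
Qed.

Lemma des_subproof (w : Omega) :
  Omega (desubst (digit (phase_of w)) (val w) : biword).
Proof. by have [u hu] := phase_of_halve w; apply: phase_Omega (phase_desubst hu). Qed.

Definition des (w : Omega) : Omega := 
  exist _ (desubst (digit (phase_of w)) (val w) : biword) (mem_set (des_subproof w)).

Lemma sub_subproof (b : bool) (w : Omega) : Omega (subst b (val w) : biword).
Proof. exact: phase_Omega (phase_subst (b := b) (@phase_ofP w)). Qed.

Definition sub (b : bool) (w : Omega) : Omega :=
  exist _ (subst b (val w) : biword) (mem_set (sub_subproof b w)).

Lemma phase_of_sub (b : bool) w :
  phase_of (sub b w) = (b : nat)%:R + 2 * phase_of w.
Proof. by apply: phase_of_eq; apply: phase_subst; apply: phase_ofP. Qed.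

Lemma des_sub b w : des (sub b w) = w.
Proof.
by apply: Omega_ext => k; rewrite /= phase_of_sub digit_double desubstK.
Qed.

Lemma sub_des w : sub (digit (phase_of w)) (des w) = w.
Proof. by have [u /substK h] := phase_of_halve w; apply: Omega_ext => k; exact: h. Qed.

Lemma phase_of_des w :
  phase_of w = (digit (phase_of w) : nat)%:R + 2 * phase_of (des w).
Proof. by rewrite -{1}(sub_des w) phase_of_sub. Qed.

(* The vertices are the six words of length 3 that occur in [Omega]. *)
Definition vertex_letters (v : vertex) : bool * bool * bool :=
  match v with
  | va => (false, true, true) | vb => (true, false, true)
  | vc => (false, false, true) | vd => (true, true, false)
  | ve => (false, true, false) | vf => (true, false, false)
  end.

Definition letters_vertex (x y z : bool) : vertex :=
  match x, y, z with
  | false, true, true => va | true, false, true => vb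
  | false, false, true => vc | true, true, false => vd
  | false, true, false => ve | true, false, false => vf
  | _, _, _ => va
  end.

Definition window (w : Omega) : vertex :=
  letters_vertex (val w (-1)) (val w 0) (val w 1).

(** One of the pairs of positions (-1, 0) and (0, 1) is a block of the substitution, according to
    the first digit of the phase, and the letters of a block differ. *)
Lemma Omega_cube_free (w : Omega) :
  ~~ [&& val w (-1) == val w 0 & val w 0 == val w 1].
Proof.
apply/negP => /andP[/eqP e0 /eqP e1].
have [u hu] := phase_of_halve w.
have := phase_odd 0 hu; rewrite mulr0 !add0r.
case: (digit _) {hu} => h.
  have {}h : val w 0 = ~~ val w (-1) := h.
  by rewrite e0 in h; case: (val w 0) h.
have {}h : val w 1 = ~~ val w 0 := h.
by rewrite -e1 in h; case: (val w 0) h.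
Qed.

Lemma window_letters w : vertex_letters (window w) = (val w (-1), val w 0, val w 1).
Proof.
have := Omega_cube_free w; rewrite /window.
by case: (val w (-1)); case: (val w 0); case: (val w 1).
Qed.

Lemma window_agree w w' : window w = window w' -> agree 1 (val w) (val w').
Proof.
move=> /(congr1 vertex_letters); rewrite !window_letters => -[e0 e1 e2] k k1.
by have [->|[->|->]] : k = -1 \/ k = 0 \/ k = 1 by lia.
Qed.

(** Each of the twelve labels is carried by exactly one edge, so a label determines its edge. *)
Definition source (l : label) : vertex :=
  match l with
  | (true, va) => vb | (true, vb) => va | (true, vc) => va
  | (true, vd) => vf | (true, ve) => vf | (true, vf) => ve
  | (false, va) => vd | (false, vb) => vc | (false, vc) => vb
  | (false, vd) => ve | (false, ve) => vd | (false, vf) => vc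
  end.

Lemma edgesP v l u : (v, l, u) \in edges -> v = source l /\ u = l.2.
Proof. by rewrite !inE; repeat case/orP; move/eqP=> [-> -> ->]. Qed.

Lemma source_edge l : (source l, l, l.2) \in edges.
Proof. by case: l => [[] []]; rewrite !inE eqxx ?orbT. Qed.

(** The new letters around 0 are w(0), ~w(0), w(1) if b = 1, and ~w(-1), w(0), ~w(0) if b = 0. The
    edges of the automaton encode these two rules, and point from a word to its desubstitution. *)
Lemma window_sub b w : window (sub b w) = source (b, window w).
Proof.
have := Omega_cube_free w; rewrite /window.
have s0 q : val (sub b w) (2 * q - (b : nat)%:Z) = val w q.
  by have := substE b false (val w) q; rewrite addr0 addbF.
have s1 q : val (sub b w) (2 * q + 1 - (b : nat)%:Z) = ~~ val w q.
  by have := substE b true (val w) q; rewrite addbT.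
case: b s0 s1 => s0 s1.
  rewrite (s0 0 : _ (-1) = _) (s1 0 : _ 0 = _) (s0 1 : _ 1 = _).
  by case: (val w (-1)); case: (val w 0); case: (val w 1).
rewrite (s1 (-1) : _ (-1) = _) (s0 0 : _ 0 = _) (s1 0 : _ 1 = _).
by case: (val w (-1)); case: (val w 0); case: (val w 1).
Qed.

(** The window is taken after n + 1 desubstitutions because a label carries the end vertex of its
    edge. *)
Definition path_of (w : Omega) (n : nat) : label :=
  (digit (phase_of (iter n des w)), window (iter n.+1 des w)).

Lemma path_of_LA w : LA (path_of w).
Proof.
exists (fun n => window (iter n des w)) => n.
set u := iter n des w; rewrite -{1}(sub_des u) window_sub.
exact: (source_edge (path_of w n)).
Qed.

Definition Theta (w : Omega) : LA := 
  exist _ (path_of w : prod_topology _) (mem_set (path_of_LA w)).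

Lemma path_of_des w n : path_of (des w) n = path_of w n.+1.
Proof. by rewrite /path_of -!iterSr. Qed.

Lemma path_of_sub0 b w : path_of (sub b w) 0 = (b, window w).
Proof. by rewrite /path_of /= des_sub phase_of_sub digit_double. Qed.

Lemma phase_of_iter_des w n :
  phase_of w = (\sum_(k < n) (digit (phase_of (iter k des w)) : nat) * 2 ^ k)%N%:R
    + 2 ^+ n * phase_of (iter n des w).
Proof.
elim: n => [|n IH]; first by rewrite big_ord0 add0r mul1r.
rewrite {1}IH big_ord_recr /= natrD {1}(phase_of_des (iter n des w)).
by rewrite natrM natrX exprSr; ring.
Qed.

Lemma phase_of_delta w : phase_of w = delta (Theta w).
Proof.
apply: residueP => n; rewrite residue_delta (phase_of_iter_des w n.+1) residueD.
by rewrite residue_2exp_mul // addr0 residue_nat.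
Qed.

Lemma subst_agree b R w w' : (0 < R)%N ->
  agree R w w' -> agree (R + R) (subst b w) (subst b w').
Proof. by move=> R0 e k kR; rewrite /subst e //; case: b; lia. Qed.

(** The last window gives agreement at radius 1, and every substitution on the way back doubles the
    radius; growth by one per label is all that is kept. *)
Lemma path_of_agree n (w w' : Omega) :
  (forall k, (k <= n)%N -> path_of w k = path_of w' k) ->
  agree n.+1 (val w) (val w').
Proof.
elim: n w w' => [|n IH] w w' e.
  have [ed /window_agree ew] := e 0%N isT.
  rewrite -(sub_des w) -(sub_des w') ed => k k1.
  by apply: subst_agree ew _ _ => //; lia.
have [ed _] := e 0%N isT.
have {}/IH ew : forall k, (k <= n)%N -> path_of (des w) k = path_of (des w') k.
  by move=> k kn; rewrite !path_of_des e.
rewrite -(sub_des w) -(sub_des w') ed => k k1.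
by apply: subst_agree ew _ _ => //; lia.
Qed.

Lemma des_agree R (w w' : Omega) :
  agree (8 + R + R) (val w) (val w') -> agree R (val (des w)) (val (des w')).
Proof.
(* Radius 8 = 2^3 decides the phase modulo 2; the remaining 2R covers the positions 2k - b up to an
   error of 1. *)
move=> e; have ed : digit (phase_of w) = digit (phase_of w').
  rewrite /digit (@phase_of_local 0 w w') // => k k8; apply: e.
  by apply: leq_trans k8 _; rewrite -addnA leq_addr.
by move=> k kR; rewrite /= /desubst ed; apply: e; case: (digit _); lia.
Qed.

Lemma iter_des_agree n R : exists R', forall w w' : Omega,
  agree R' (val w) (val w') -> agree R (val (iter n des w)) (val (iter n des w')).
Proof.
elim: n R => [|n IH] R; first by exists R.
by have [R' H] := IH (8 + R + R)%N; exists R' => w w' /H /des_agree.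
Qed.

Lemma path_of_local n : exists R, forall w w' : Omega,
  agree R (val w) (val w') -> path_of w n = path_of w' n.
Proof.
(* Here 10 = 8 + 1 + 1: it gives the digit, and radius 1 after one more desubstitution. *)
have [R H] := iter_des_agree n 10; exists R => w w' /H e.
have e8 : agree 8 (val (iter n des w)) (val (iter n des w')).
  by move=> k k8; apply: e; apply: leq_trans k8 _.
rewrite /path_of /digit (@phase_of_local 0 _ (iter n des w')) //.
have e1 : agree 1 (val (iter n.+1 des w)) (val (iter n.+1 des w')) by exact: des_agree.
by rewrite /window !e1.
Qed.

Lemma Theta_continuous : continuous Theta.
Proof.
apply: continuous_LA => w n; have [R H] := path_of_local n.
by apply: filterS (nbhs_Omega_agree w R) => w' /H /= ->.
Qed.

Lemma Omega_letters (y d e : bool) : d || e -> exists w : Omega,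
  [/\ val w (-1) = y (+) d, val w 0 = y & val w 1 = y (+) e].
Proof.
move=> de; have [j [j0 jd je]] : exists j, [/\ (0 < j)%N,
    ~~ odd (logn 2 j) = d & ~~ odd (logn 2 j.+1) = e].
  (* The valuations of j and j + 1 are 0 and 2 for j = 3, 0 and 1 for j = 1, 1 and 0 for j = 2. *)
  by case: d e de => -[] // _; [exists 3|exists 1|exists 2].
pose w := Omega_word (y : nat)%:R (Int j 0).
have w0 : val w 0 = y by rewrite /= word0 F2_nat_eq1 oddb.
have hw : phase (val w) j%:R by exact: phase_word.
have := hw 0 (logn 2 j); rewrite addr0 => /(_ (level_nat j0)).
have := hw 1 (logn 2 j.+1); rewrite natr1 => /(_ (level_nat (ltn0Sn _))).
rewrite /step subrr sub0r w0 jd je => <- <-; exists w; split=> //.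
  by rewrite addbC addbK.
by rewrite addKb.
Qed.

Lemma window_surj (v : vertex) : exists w, window w = v.
Proof.
pose l := vertex_letters v.
have [|w [w1 w2 w3]] := @Omega_letters l.1.2 (l.1.1 (+) l.1.2) (l.1.2 (+) l.2).
  by rewrite /l; case: (v).
by exists w; rewrite /window w1 w2 w3 /l; case: (v).
Qed.

(** Start from a word whose window is the n-th vertex and substitute backwards along the digits;
    [window_sub] recovers the earlier vertices. *)
Lemma path_of_prefix n (v : nat -> vertex) (p : nat -> label) :
  (forall k, (v k, p k, v k.+1) \in edges) -> exists w,
  window w = v 0%N /\ forall k, (k < n)%N -> path_of w k = p k.
Proof.
elim: n v p => [|n IH] v p vp.
  by have [w we] := window_surj (v 0%N); exists w.
have [w [w1 wp]] := IH _ _ (fun k => vp k.+1).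
have [v0 v1] := edgesP (vp 0%N); exists (sub (p 0%N).1 w).
have p0 : ((p 0%N).1, window w) = p 0%N by rewrite w1 v1; case: (p 0%N).
split=> [|[|k] kn]; first by rewrite window_sub p0.
  by rewrite path_of_sub0.
by rewrite -path_of_des des_sub wp.
Qed.

Lemma Theta_inj : injective Theta.
Proof.
move=> w w' e; apply: Omega_ext => k.
have {}e n : path_of w n = path_of w' n by have := congr1 val e => /= ->.
by apply: (@path_of_agree `|k| w w') => //; lia.
Qed.

Lemma Theta_surj (p : LA) : exists w, Theta w = p.
Proof.
have [v vp] := set_mem (valP p).
have /choice[f fP] : forall n, exists w : Omega,
    forall k, (k <= n)%N -> path_of w k = val p k.
  by move=> n; have [w [_ wp]] := path_of_prefix n.+1 vp; exists w.
(* The words realizing longer and longer prefixes agree on growing intervals, and [w0] is their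
   limit, read diagonally. *)
pose w0 : biword := fun k => val (f `|k|%N) k.
have w0f n : agree n w0 (val (f n)).
  move=> k kn; apply: (@path_of_agree `|k| (f `|k|%N) (f n)); last by lia.
  by move=> j jk; rewrite !fP // (leq_trans jk).
have w0O : Omega w0.
  apply/OmegaP => m l; pose n := (`|m| + l)%N.
  have /OmegaP/(_ m l)[i Hi] := set_mem (valP (f n)).
  by exists i => k kl; rewrite (w0f n) ?Hi //; lia.
pose w : Omega := exist _ w0 (mem_set w0O); exists w; apply/val_inj/funext => n.
have [R H] := path_of_local n.
(* The index R + n serves twice: the approximation has the right n-th label and agrees with [w] on
   radius R. *)
rewrite -(fP (R + n)%N n) ?leq_addl //; apply: H => k kR.
by apply: w0f; apply: leq_trans kR _; rewrite leq_addr.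
Qed.

Lemma Theta_homeomorphism : homeomorphism Theta.
Proof.
split; first exact: Theta_continuous.
have [g gK] := choice Theta_surj; exists g; split=> //.
  by move=> w; apply: Theta_inj; rewrite gK.
apply: continuous_Omega => p k.
apply: filterS (nbhs_LA_prefix p `|k|.+1) => q /= e.
apply: (@path_of_agree `|k|) => [j jk|]; last by lia.
by have := e j jk; rewrite -{1}(gK q) -{1}(gK p).
Qed.

(** * The fibres of the phase *)

Lemma fiber_card2 (z : Z2) : ~ ZinZ2 z -> (phase_of @^-1` [set z] #= `I_2)%card.
Proof.
move=> zn; apply/card_set_bijP; exists (fun w => (Psi w).1 : nat); split.
- by move=> w _ /=; exact: ltn_ord.
- move=> w w'; rewrite !inE /= -!Ztilde_Z2_Psi => ez ez' es.
  rewrite -(PsiK w) -(PsiK w'); congr Omega_word; first exact: val_inj.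
  case: (Psi w).2 (Psi w').2 ez ez' => [u|m t] [u'|m' t'] /= ez ez'.
  + by congr Nonint; apply: val_inj; exact: etrans ez (esym ez').
  + by case: zn; exists m'.
  + by case: zn; exists m.
  + by case: zn; exists m.
move=> n /= n2; pose x := Nonint (exist _ z (mem_set (zn : (~` ZinZ2) z))).
by exists (Omega_word (Ordinal n2 : 'Z_2) x); rewrite ?phase_of_word // Psi_word.
Qed.

Lemma F2_lt2 (t : 'Z_2) : (t < 2)%N.
Proof. exact: ltn_ord. Qed.

(** The value 0 at [Nonint] points is a dummy: the branch serves to count fibres over integers. *)
Definition Ztilde_branch (x : Ztilde) : 'Z_2 := if x is Int _ t then t else 0.

Lemma fiber_card4 (z : Z2) : ZinZ2 z -> (phase_of @^-1` [set z] #= `I_4)%card.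
Proof.
move=> [m zm]; apply/card_set_bijP.
(* Over an integer a word is given by its letter at 0 and a branch, here read as two binary
   digits. *)
exists (fun w => ((Psi w).1 : nat) + 2 * (Ztilde_branch (Psi w).2 : nat))%N; split.
- move=> w _ /=; have := F2_lt2 (Psi w).1; have := F2_lt2 (Ztilde_branch (Psi w).2).
  lia.
- move=> w w'; rewrite !inE /= -!Ztilde_Z2_Psi => ez ez' e.
  have := F2_lt2 (Psi w).1; have := F2_lt2 (Psi w').1; move=> lw' lw.
  have es : (Psi w).1 = (Psi w').1 by apply: val_inj => /=; lia.
  have et : Ztilde_branch (Psi w).2 = Ztilde_branch (Psi w').2.
    by apply: val_inj => /=; lia.
  rewrite -(PsiK w) -(PsiK w') es; congr Omega_word.
  case: (Psi w).2 (Psi w').2 ez ez' et => [u|k t] [u'|k' t'] /= ez ez'.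
  + by case: (set_mem (valP u)); exists m; exact: etrans ez zm.
  + by case: (set_mem (valP u)); exists m; exact: etrans ez zm.
  + by case: (set_mem (valP u')); exists m; exact: etrans ez' zm.
  by move=> ->; congr Int; apply: Z2_int_inj; exact: etrans ez (esym ez').
move=> n /= n4.
have [s [t nE]] : exists s t : 'Z_2, n = (s + 2 * t)%N.
  have s2 : (n %% 2 < 2)%N by rewrite ltn_mod.
  have t2 : (n %/ 2 < 2)%N by lia.
  by exists (Ordinal s2), (Ordinal t2); rewrite /=; lia.
by exists (Omega_word s (Int m t)); rewrite ?phase_of_word ?zm // Psi_word.
Qed.

Theorem theorem1 :
  exists (Theta : Omega -> LA) (pi : Omega -> Z2),
    (homeomorphism Theta /\
     (forall w : Omega, pi w = delta (Theta w)) /\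
     continuous pi /\
     (forall z : Z2, exists w : Omega, pi w = z) /\
     (forall w : Omega, pi (sigma w) = pi w + 1) /\
     (forall z : Z2, ~ ZinZ2 z -> (pi @^-1` [set z] #= `I_2)%card) /\
     (forall z : Z2, ZinZ2 z -> (pi @^-1` [set z] #= `I_4)%card))
    /\
    (exists Psi : Omega -> 'Z_2 * Ztilde,
       homeomorphism Psi /\
       (forall (w : Omega) (s : 'Z_2) (z : Ztilde), Psi w = (s, z) ->
          Psi (sigma w) = (s + phi (translate 1 z), translate 1 z)) /\
       (forall w : Omega, pi w = Ztilde_Z2 (Psi w).2)).
Proof.
exists Theta, phase_of; split.
  split; first exact: Theta_homeomorphism.
  split; first exact: phase_of_delta.
  split; first exact: phase_of_continuous.
  split; last first.
    split; first exact: phase_of_sigma.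
    by split; [exact: fiber_card2|exact: fiber_card4].
  move=> z; case: (pselect (ZinZ2 z)) => [[m ->]|zn].
    by exists (Omega_word 0 (Int m 0)); rewrite phase_of_word.
  exists (Omega_word 0 (Nonint (exist _ z (mem_set (zn : (~` ZinZ2) z))))).
  by rewrite phase_of_word.
exists Psi; split.
  split; first exact: Psi_continuous.
  exists (fun p => Omega_word p.1 p.2); split=> [w|[s x]|].
  - exact: PsiK.
  - exact: Psi_word.
  - exact: Omega_word_continuous.
split=> [w s z e|w]; last by rewrite Ztilde_Z2_Psi.
by rewrite -(PsiK w) e sigma_word Psi_word.
Qed.
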